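(* In the setting of top and bottom sequences given in the context, fix an index $i$ and assume: (A1) $\hat R_i:X_i\to\hat X_i$ is continuous, with operator norm $\|\hat R_i\|$; (A2) $E_i\hat I_ix_p=I_ix_p$ for all $x_p\in\mathcal P^{k_i}$; (A3) $I_i:\mathcal H_i\to X_i$ is continuous for the norms $\|\cdot\|_{\mathcal H,i}$ and $\|\cdot\|_{X,i}$, with operator norm $\|I_i\|$; and that $P_i$ is polynomially consistent, in the sense that $P_iI_iv_p=v_p$ for all $v_p\in\mathcal P^{k_i}$. Then $\hat P_i$ is also polynomially consistent, in the sense that $\hat P_i\hat I_iv_p=v_p$ for all $v_p\in\mathcal P^{k_i}$, and moreover $$\|\hat P_i\hat I_iv-v\|_{\mathcal L,i}\le\left(\|P_i\|\,\|\hat R_i\|\,\|I_i\|+1\right)\omega_i(v)\qquad\forall v\in\mathcal H_i,$$ where $\omega_i(v):=\inf_{v_p\in\mathcal P^{k_i}}\|v-v_p\|_{\mathcal H,i}$.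
   Context: $(X_i,d_i)_i$ (top sequence) is a complex of real vector spaces with inner products $(\cdot,\cdot)_{X,i}$ and norms $\|\cdot\|_{X,i}$. $(\hat X_i)_i$ (bottom sequence) is a second sequence of real vector spaces, with linear maps $E_i:\hat X_i\to X_i$ (extensions) and $\hat R_i:X_i\to\hat X_i$ (reductions). The inner product on $\hat X_i$ is $(\hat x,\hat y)_{\hat X,i}:=(E_i\hat x,E_i\hat y)_{X,i}$, with norm $\|\hat x\|_{\hat X,i}=\|E_i\hat x\|_{X,i}$ (it is understood that this is an inner product, i.e. that $E_i$ is injective). For each $i$, $\mathcal H_i$ is a Hilbert space with norm $\|\cdot\|_{\mathcal H,i}$, $\mathcal P^{k_i}\subset\mathcal H_i$ is a (polynomial) linear subspace, and $I_i:\mathcal H_i\to X_i$ is a linear map (interpolator). $\mathcal L_i$ is an ''$L^2$-like'' space with inner product $(\cdot,\cdot)_{\mathcal L,i}$ and norm $\|\cdot\|_{\mathcal L,i}$ in which $\mathcal H_i$ is continuously embedded: $\|v\|_{\mathcal L,i}\le c_{\mathcal H,i}\|v\|_{\mathcal H,i}$ for all $v\in\mathcal H_i$. The interpolator of the bottom sequence is $\hat I_i:=\hat R_iI_i$. The potential reconstruction $P_i:X_i\to\mathcal P^{k_i}$ is a linear map, with operator norm $\|P_i\|$ when $\mathcal P^{k_i}$ is endowed with the norm $\|\cdot\|_{\mathcal L,i}$, and $\hat P_i:=P_iE_i:\hat X_i\to\mathcal P^{k_i}$.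
   Formalization: The bound with ''+1'' fails when the embedding constant c_{H,i} exceeds 1; the formal theorem proves it with ''+c_{H,i}'' in place of ''+1'' for every c_{H,i}, and with ''+1'' under the added assumption c_{H,i} ≤ 1. *)

(* Defs.v *)
From HB Require Import structures.
From mathcomp Require Import all_boot all_order all_algebra.
From mathcomp Require Import all_classical all_reals all_analysis.

Set Implicit Arguments.
Unset Strict Implicit.
Unset Printing Implicit Defensive.

Import Order.TTheory GRing.Theory Num.Theory.
Import numFieldNormedType.Exports.

Local Open Scope classical_set_scope.
Local Open Scope ring_scope.

(* An inner product on a normed module whose norm is the one of the module.
   Inner product spaces are normed modules with such a form, so that continuity
   refers to the library topology; Hilbert spaces are the complete ones. *)
Definition induces_norm (R : realType) (V : normedModType R)
    (ip : {dot V for @idfun R}) : Prop :=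
  forall x : V, `|x| ^+ 2 = ip x x.

(* The supremum is only meaningful (finite) when f is bounded. *)
Definition opnorm (R : realType) (V W : normedModType R) (f : V -> W) : R :=
  sup [set `|f x| | x in [set x : V | `|x| <= 1]].

Definition poly_consistent (R : realType) (H : normedModType R) (X : Type)
    (Pk : submodClosed H) (P : X -> H) (I : H -> X) : Prop :=
  forall vp : H, vp \in Pk -> P (I vp) = vp.

(* Sequences are indexed by int; a one-sided or finite sequence is extended
   by zero spaces. *)
Record setting (R : realType) := Setting {
  X_ : int -> normedModType R;
  ipX_ : forall i, {dot (X_ i) for @idfun R};
  ipX_norm : forall i, induces_norm (ipX_ i);
  d_ : forall i, {linear X_ i -> X_ (i + 1)};
  d_complex : forall i (x : X_ i), d_ (i + 1) (d_ i x) = 0;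
  hatX_ : int -> normedModType R;
  E_ : forall i, {linear hatX_ i -> X_ i};
  hatR_ : forall i, {linear X_ i -> hatX_ i};
  ip_hatX_ : forall i, {dot (hatX_ i) for @idfun R};
  ip_hatX_def : forall i (x y : hatX_ i),
    ip_hatX_ i x y = ipX_ i (E_ i x) (E_ i y);
  (* as hatX_ i is a normed module, this forces E_ i to be injective *)
  hat_norm : forall i (x : hatX_ i), `|x| = `|E_ i x|;
  H_ : int -> completeNormedModType R;
  ipH_ : forall i, {dot (H_ i) for @idfun R};
  ipH_norm : forall i, induces_norm (ipH_ i);
  Pk_ : forall i, submodClosed (H_ i);
  I_ : forall i, {linear H_ i -> X_ i};
  L_ : int -> normedModType R;
  ipL_ : forall i, {dot (L_ i) for @idfun R};
  ipL_norm : forall i, induces_norm (ipL_ i);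
  (* the inclusion of H_ i in the L^2-like space L_ i *)
  emb_ : forall i, {linear H_ i -> L_ i};
  emb_inj : forall i, injective (emb_ i);
  cH_ : int -> R;
  cH_bound : forall i (v : H_ i), `|emb_ i v| <= cH_ i * `|v|;
  (* a map into Pk_ i is a map into H_ i whose values lie in Pk_ i *)
  P_ : forall i, {linear X_ i -> H_ i};
  P_poly : forall i (x : X_ i), P_ i x \in Pk_ i
}.

Section derived.
Variables (R : realType) (S : setting R) (i : int).

Definition hatI : H_ S i -> hatX_ S i := hatR_ S i \o I_ S i.

Definition hatP : hatX_ S i -> H_ S i := P_ S i \o E_ S i.

(* P_ i with its target measured in the norm of L_ i. *)
Definition P_L : X_ S i -> L_ S i := emb_ S i \o P_ S i.

Definition omega (v : H_ S i) : R :=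
  inf [set `|v - vp| | vp in [set vp : H_ S i | vp \in Pk_ S i]].

End derived.

Arguments hatI {R} S i _.
Arguments hatP {R} S i _.
Arguments P_L {R} S i _.
Arguments omega {R} S i _.

(* Main.v *)
(* Consistency gives [hatP (hatI v) - v = hatP (hatI (v - vp)) - (v - vp)] for
   every polynomial [vp]; since [E_] is an isometry, the first term is bounded
   by the three operator norms times [`|v - vp|] and the second one by the
   embedding, and one takes the infimum over [vp]. *)
Require Import Defs.
From mathcomp Require Import all_boot all_order all_algebra.
From mathcomp Require Import all_classical all_reals all_analysis.
Import Order.TTheory GRing.Theory Num.Theory.
Import numFieldNormedType.Exports.
Local Open Scope classical_set_scope.
Local Open Scope ring_scope.

Lemma opnorm_ge0 (R : realType) (V W : normedModType R) (f : V -> W) :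
  0 <= opnorm f.
Proof.
rewrite /opnorm; set A := [set _ | _ in _].
(* When [A] has no supremum, [sup A] is the default value 0; otherwise it dominates the norm of
   [f 0]. *)
have [[_ A_ub]|/sup_out -> //] := pselect (has_sup A).
apply: le_trans (normr_ge0 (f 0)) _.
by apply: ub_le_sup => //; exists 0 => //=; rewrite normr0.
Qed.

(** Homogeneity reduces the claim to the unit vector along [x]. Continuity provides a Lipschitz
    constant, which bounds the set under the supremum. *)
Lemma le_opnorm (R : realType) (V W : normedModType R) (f : {linear V -> W})
    (x : V) :
  continuous f -> `|f x| <= opnorm f * `|x|.
Proof.
move=> /linear_lipschitz [k k_gt0 fk].
have [->|x_neq0] := eqVneq x 0; first by rewrite linear0 !normr0 mulr0.
have x_gt0 : 0 < `|x| by rewrite normr_gt0.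
rewrite -ler_pdivrMr// mulrC.
have -> : `|x|^-1 * `|f x| = `|f (`|x|^-1 *: x)|.
  by rewrite linearZ normrZ normfV normr_id.
apply: ub_le_sup.
  exists k => _ [y /= y_le1 <-]; apply: le_trans (fk y) _.
  by rewrite ler_piMr// ltW.
by exists (`|x|^-1 *: x) => //=; rewrite normrZ normfV normr_id mulVf// gt_eqF.
Qed.

(* No sign condition on [K]: for [K < 0] the hypotheses force [A = [set 0]]. *)
Lemma le_mul_inf (R : realType) (A : set R) (K a : R) :
  A !=set0 -> lbound A 0 -> 0 <= a ->
  (forall x, A x -> a <= K * x) -> a <= K * inf A.
Proof.
move=> A_neq0 A_ge0 a_ge0 aK; have [K_gt0|K_le0] := ltP 0 K.
  rewrite mulrC -ler_pdivrMr//; apply: lb_le_inf => // x /aK.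
  by rewrite ler_pdivrMr// mulrC.
case: A_neq0 => x Ax; apply: (le_trans (aK x Ax)); apply: ler_wnM2l => //.
by apply: ge_inf => //; exists 0.
Qed.

Lemma hatP_consistent (R : realType) (S : setting R) (i : int) :
  (forall xp : H_ S i, xp \in Pk_ S i ->
     E_ S i (hatI S i xp) = I_ S i xp) ->
  poly_consistent (Pk_ S i) (P_ S i) (I_ S i) ->
  poly_consistent (Pk_ S i) (hatP S i) (hatI S i).
Proof. by move=> EI PI vp vpP; rewrite /hatP /= EI// PI. Qed.

Lemma norm_hatP_hatI (R : realType) (S : setting R) (i : int) (w : H_ S i) :
  continuous (P_L S i) -> continuous (hatR_ S i) -> continuous (I_ S i) ->
  `|emb_ S i (hatP S i (hatI S i w))| <=
    opnorm (P_L S i) * opnorm (hatR_ S i) * opnorm (I_ S i) * `|w|.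
Proof.
move=> Pc Rc Ic.
(* The composite is written out, instead of [P_L], so that its linear structure is inferred. *)
have Pbound := le_opnorm _ _ _ (emb_ S i \o P_ S i) (E_ S i (hatI S i w)) Pc.
apply: (le_trans Pbound).
rewrite -!mulrA; apply: ler_wpM2l; first exact: opnorm_ge0.
rewrite -hat_norm; apply: (le_trans (le_opnorm _ _ _ _ (I_ S i w) Rc)).
by apply: ler_wpM2l; [exact: opnorm_ge0|exact: le_opnorm].
Qed.

(** The embedding bound [c] is a parameter, so that both [cH_ S i] and 1 can be substituted for
    it. *)
Lemma hatP_hatI_approx (R : realType) (S : setting R) (i : int) (c : R) :
  continuous (P_L S i) -> continuous (hatR_ S i) -> continuous (I_ S i) ->
  poly_consistent (Pk_ S i) (hatP S i) (hatI S i) ->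
  (forall w : H_ S i, `|emb_ S i w| <= c * `|w|) ->
  forall v : H_ S i,
    `|emb_ S i (hatP S i (hatI S i v)) - emb_ S i v| <=
      (opnorm (P_L S i) * opnorm (hatR_ S i) * opnorm (I_ S i) + c)
        * omega S i v.
Proof.
move=> Pc Rc Ic PI embc v; apply: le_mul_inf => //.
- by exists `|v - 0|, 0 => //=; exact: rpred0.
- by move=> _ [vp _ <-].
move=> _ [vp /= vpP <-].
have -> : emb_ S i (hatP S i (hatI S i v)) - emb_ S i v =
    emb_ S i (hatP S i (hatI S i (v - vp))) - emb_ S i (v - vp).
  rewrite [in RHS]/hatP [in RHS]/hatI /= !linearB /=.
  (* Refolding lets consistency turn this term into [vp]; the two copies of [emb_ S i vp] then
     cancel. *)
  rewrite -[P_ S i (E_ S i (hatR_ S i (I_ S i vp)))]/(hatP S i (hatI S i vp)).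
  by rewrite (PI vp)// opprK [- _ + _]addrC addrA subrK.
rewrite mulrDl; apply: le_trans (ler_normB _ _) _.
by apply: lerD; [exact: norm_hatP_hatI|exact: embc].
Qed.

(** The term [|v - vp|] is measured in [L_], so passing to the norm of [H_] costs the embedding
    constant; it becomes the 1 of the classical estimate when [cH_ S i <= 1]. *)
Theorem proposition7 (R : realType) (S : setting R) (i : int)
    (P_continuous : continuous (P_L S i))
    (A1 : continuous (hatR_ S i))
    (A2 : forall xp : H_ S i, xp \in Pk_ S i -> E_ S i (hatI S i xp) = I_ S i xp)
    (A3 : continuous (I_ S i))
    (P_consistent : poly_consistent (Pk_ S i) (P_ S i) (I_ S i)) :
  poly_consistent (Pk_ S i) (hatP S i) (hatI S i) /\
  (forall v : H_ S i,
     `|emb_ S i (hatP S i (hatI S i v)) - emb_ S i v| <=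
       (opnorm (P_L S i) * opnorm (hatR_ S i) * opnorm (I_ S i) + cH_ S i)
         * omega S i v) /\
  (cH_ S i <= 1 ->
   forall v : H_ S i,
     `|emb_ S i (hatP S i (hatI S i v)) - emb_ S i v| <=
       (opnorm (P_L S i) * opnorm (hatR_ S i) * opnorm (I_ S i) + 1)
         * omega S i v).
Proof.
have hatPI := hatP_consistent _ S i A2 P_consistent.
split=> //; split=> [|cH_le1]; apply: hatP_hatI_approx => // w.
  exact: cH_bound.
by apply: le_trans (cH_bound w) _; rewrite ler_wpM2r.
Qed.
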